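(* Let $R$ be a commutative ring with $1\neq 0$ that is not a quasilocal ring. Then a proper ideal $I$ of $R$ is a 1-absorbing primary ideal of $R$ if and only if $I$ is a primary ideal of $R$. In particular, if $R=R_1\times R_2$ for some commutative rings $R_1$ and $R_2$ with $1\neq 0$, then a proper ideal $I$ of $R$ is a 1-absorbing primary ideal of $R$ if and only if $I$ is a primary ideal of $R$.
   Context: All rings are commutative with $1\neq 0$. A ring is quasilocal if it has exactly one maximal ideal. For an ideal $I$ of $R$, $\sqrt{I}=\{r\in R \mid r^{n}\in I \text{ for some integer } n\geq 1\}$. A proper ideal $I$ of $R$ is called a 1-absorbing primary ideal of $R$ if whenever $a,b,c\in R$ are nonunit elements with $abc\in I$, then $ab\in I$ or $c\in\sqrt{I}$. *)

(* Defs.v *)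
(* Commutative rings with 1 <> 0 are MathComp's [comNzRingType]; ideals are
   arbitrary subsets [I : set R] in the sense of MathComp's classical_sets. *)
From mathcomp Require Import all_boot all_algebra.
From mathcomp Require Import boolp classical_sets.

Set Implicit Arguments.
Unset Strict Implicit.
Unset Printing Implicit Defensive.

Import GRing.Theory.

Local Open Scope classical_set_scope.
Local Open Scope ring_scope.

(* [GRing.unit] would require a [comUnitRingType], i.e. a boolean unit test and
   an inverse function as additional structure on the ring. *)
Definition nonunit (R : comNzRingType) (a : R) : Prop :=
  ~ exists b : R, a * b = 1.

(* [idealr_closed] includes properness (1 is not a member).  It is stated for
   boolean predicates; [in I] is the classical membership test of the set I. *)
Definition proper_ideal_set (R : comNzRingType) (I : set R) : Prop :=
  idealr_closed [in I].

Definition maximal_ideal (R : comNzRingType) (M : set R) : Prop :=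
  proper_ideal_set M /\
  forall J : set R, proper_ideal_set J -> M `<=` J -> J = M.

Definition quasilocal (R : comNzRingType) : Prop :=
  exists! M : set R, maximal_ideal M.

Definition radical (R : comNzRingType) (I : set R) : set R :=
  [set r | exists2 n : nat, (1 <= n)%N & I (r ^+ n)].

Definition primary_ideal (R : comNzRingType) (I : set R) : Prop :=
  proper_ideal_set I /\
  forall a b : R, I (a * b) -> I a \/ radical I b.

Definition one_absorbing_primary_ideal (R : comNzRingType) (I : set R) : Prop :=
  proper_ideal_set I /\
  forall a b c : R, nonunit a -> nonunit b -> nonunit c ->
    I (a * b * c) -> I (a * b) \/ radical I c.

(* Main.v *)
Require Import Defs.
From mathcomp Require Import all_boot all_algebra.
From mathcomp Require Import boolp classical_sets.

(** A 1-absorbing primary ideal [I] is primary as soon as [1] is a sum of two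
    nonunits [x + y].  Indeed, let [a * b] be in [I] with [a], [b] nonunits and
    [b] not in the radical of [I].  From [x * a * b] and [y * a * b] in [I] one
    gets [x * a] and [y * a] in [I], so their sum [a] is in [I].  If [1] is not
    a sum of two nonunits, the nonunits form an ideal, which contains every
    proper ideal, so the ring is quasilocal.  In a product ring,
    [1 = (1, 0) + (0, 1)]. *)

Import GRing.Theory.
Local Open Scope classical_set_scope.
Local Open Scope ring_scope.

(** Passes from the boolean test [[in I]] to [I] as a predicate. *)
Lemma proper_ideal_setP (R : comNzRingType) (I : set R) :
  proper_ideal_set I <->
  [/\ I 0, ~ I 1 & forall a u v, I u -> I v -> I (a * u + v)].
Proof.
split=> [[I0 I1 IM]|[I0 I1 IM]].
  split=> [||a u v Iu Iv].
  - exact: set_mem I0.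
  - by move=> /mem_set; apply/negP.
  - by apply: set_mem; apply: IM; apply: mem_set.
split=> [||a u v /set_mem Iu /set_mem Iv].
- exact: mem_set.
- by apply/negP => /set_mem.
- exact/mem_set/IM.
Qed.

Lemma ideal_set_mull (R : comNzRingType) (I : set R) (a u : R) :
  proper_ideal_set I -> I u -> I (a * u).
Proof.
by move=> /proper_ideal_setP[I0 _ IM] Iu; rewrite -[a * u]addr0; apply: IM.
Qed.

Lemma nonunit_mull (R : comNzRingType) (a b : R) : nonunit b -> nonunit (a * b).
Proof. by move=> nb [c abc1]; apply: nb; exists (a * c); rewrite mulrCA mulrA. Qed.

Lemma proper_ideal_nonunit (R : comNzRingType) (I : set R) (a : R) :
  proper_ideal_set I -> I a -> nonunit a.
Proof.
move=> idI Ia [b ab1]; have [_ I1 _] := (proper_ideal_setP _ I).1 idI.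
by apply: I1; rewrite -ab1 mulrC; apply: ideal_set_mull.
Qed.

(** Primariness is applied to the two factors [a * b] and [c]. *)
Lemma primary_one_absorbing (R : comNzRingType) (I : set R) :
  primary_ideal I -> one_absorbing_primary_ideal I.
Proof. by move=> [idI primI]; split=> // a b c _ _ _; apply: primI. Qed.

Lemma one_absorbing_primary (R : comNzRingType) (I : set R) (x y : R) :
  nonunit x -> nonunit y -> x + y = 1 ->
  one_absorbing_primary_ideal I -> primary_ideal I.
Proof.
move=> nx ny xy1 [idI absI]; split=> // a b Iab.
have [_ _ IM] := (proper_ideal_setP _ I).1 idI.
(* Units are settled first: if [b] is a unit, [a] is a multiple of [a * b]; if [a] is a unit, [b] is
   one, so exponent 1 puts it in the radical. *)
have [[b' bb'1]|nb] := pselect (exists b', b * b' = 1).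
  by left; rewrite -[a]mulr1 -bb'1 mulrA mulrC; apply: ideal_set_mull.
have [[a' aa'1]|na] := pselect (exists a', a * a' = 1).
  right; exists 1%N => //; rewrite expr1 -[b]mul1r -aa'1 mulrAC mulrC.
  exact: ideal_set_mull.
have [|nradb] := pselect (radical I b); first by right.
have Imul z : nonunit z -> I (z * a).
  move=> nz; have /(absI z a b nz na nb)[] // : I (z * a * b).
  by rewrite -mulrA; apply: ideal_set_mull.
left; have := IM 1 _ _ (Imul x nx) (Imul y ny).
by rewrite mul1r -mulrDl xy1 mul1r.
Qed.

Lemma quasilocal_nonunitD (R : comNzRingType) :
  (forall x y : R, nonunit x -> nonunit y -> x + y <> 1) -> quasilocal R.
Proof.
move=> nonunitD; pose M : set R := [set a | nonunit a].
have subM (J : set R) : proper_ideal_set J -> J `<=` M.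
  by move=> idJ a; apply: proper_ideal_nonunit.
have idM : proper_ideal_set M.
  apply/proper_ideal_setP; split=> [[b]|[]|a u v nu nv [c uvc1]].
  - by rewrite mul0r => /esym/eqP; rewrite oner_eq0.
  - by exists 1; rewrite mulr1.
  (* Were [a * u + v] a unit with inverse [c], distributing [c] would write 1 as a sum of two
     nonunits. *)
  - apply: (nonunitD (c * (a * u)) (c * v)); try exact: nonunit_mull.
      by do 2!apply: nonunit_mull.
    by rewrite -mulrDr mulrC.
(* Uniqueness: a maximal [J] lies in the proper ideal [M], hence equals it. *)
exists M; split=> [|J [idJ maxJ]]; last exact: (maxJ _ idM (subM _ idJ)).
by split=> // J idJ MJ; apply/seteqP; split=> //; apply: subM.
Qed.

Theorem theorem4 :
  (forall R : comNzRingType, ~ quasilocal R ->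
    forall I : set R, proper_ideal_set I ->
      (one_absorbing_primary_ideal I <-> primary_ideal I))
  /\
  (forall (R1 R2 : comNzRingType) (I : set (R1 * R2)%type),
    proper_ideal_set I ->
      (one_absorbing_primary_ideal I <-> primary_ideal I)).
Proof.
split=> [R nql I _|R1 R2 I _]; split; try exact: primary_one_absorbing.
  move=> absI; apply: contrapT => nprimI; apply: nql.
  apply: quasilocal_nonunitD => x y nx ny xy1; apply: nprimI.
  exact: (one_absorbing_primary _ _ x y).
apply: (one_absorbing_primary _ _ (1, 0) (0, 1)).
(* Any multiple of [(1, 0)] has second coordinate 0, so it is not 1; symmetrically for [(0, 1)]. *)
- by move=> [b [_ /esym/eqP]]; rewrite mul0r oner_eq0.
- by move=> [b [/esym/eqP]]; rewrite mul0r oner_eq0.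
- by congr (_, _); rewrite /= ?addr0 ?add0r.
Qed.
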